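(* Let $q\ge 2$ and $s\ge q$ be integers. Let $U$ be the unicyclic graph consisting of a cycle of length $2q$ together with, for each vertex of the cycle, exactly $s$ pendant vertices (vertices of degree $1$) adjacent to that cycle vertex, and no other vertices. Let $\ell=2qs$ be the total number of pendant vertices and let $\Delta$ be the distance squared matrix of $U$. Then $i_-(\Delta)=\ell$.
   Context: For a connected graph $G$ with vertices $1,\dots,n$, the distance squared matrix $\Delta$ is the $n\times n$ matrix with $(i,j)$ entry $d_{ij}^2$, where $d_{ij}$ is the graph distance between $i$ and $j$. For a real symmetric matrix $M$, $i_-(M)$ denotes the number of negative eigenvalues of $M$ counted with multiplicity. *)

(* Defs.v *)
From HB Require Import structures.
From mathcomp Require Import all_boot all_order all_algebra.
From mathcomp Require Import polyrcf.
From mathcomp Require Import reals.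
Set Implicit Arguments. Unset Strict Implicit. Unset Printing Implicit Defensive.
Import Order.TTheory GRing.Theory Num.Theory.
Local Open Scope ring_scope.

Definition expand (T : finType) (e : rel T) (A : {set T}) : {set T} :=
  A :|: [set z | [exists w in A, e w z]].

Definition gball (T : finType) (e : rel T) (x : T) (n : nat) : {set T} :=
  iter n (expand e) [set x].

(* Graph distance: least n with y in ball of radius n around x
   (for connected graphs this is always < #|T|). *)
Definition gdist (T : finType) (e : rel T) (x y : T) : nat :=
  find (fun n => y \in gball e x n) (iota 0 #|T|).

Definition connected_graph (T : finType) (e : rel T) : Prop :=
  forall x y : T, y \in gball e x #|T|.

Definition dist_sq_matrix (R : nzRingType) (T : finType) (e : rel T)
  : 'M[R]_#|T| :=
  \matrix_(i, j) ((gdist e (enum_val i) (enum_val j)) ^ 2)%:R.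

Definition neg_inertia (R : rcfType) (n : nat) (M : 'M[R]_n) : nat :=
  let p := char_poly M in
  (\sum_(x <- rootsR p | (x < 0)%R) mup x p)%N.

(* Vertices: inl i = cycle vertex i (i < 2q);
             inr (i, k) = k-th pendant vertex (k < s) attached to cycle vertex i. *)
Definition Uvert (q s : nat) : finType := ('I_(2 * q) + 'I_(2 * q) * 'I_s)%type.

Definition Uadj (q s : nat) : rel (Uvert q s) :=
  fun x y =>
    match x, y with
    | inl i, inl j => ((i.+1 %% (2 * q))%N == j) || ((j.+1 %% (2 * q))%N == i)
    | inl i, inr (k, _) => k == i
    | inr (k, _), inl i => k == i
    | inr _, inr _ => false
    end.

(* Main.v *)
Require Import Defs.
From HB Require Import structures.
From mathcomp Require Import all_boot all_order all_algebra.
From mathcomp Require Import polyrcf complex reals.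
From mathcomp Require Import ring lra zify.
Set Implicit Arguments. Unset Strict Implicit. Unset Printing Implicit Defensive.
Import Order.TTheory GRing.Theory Num.Theory.
Local Open Scope ring_scope.

(* Write x for the part of a vector on the cycle, y for the part on the pendant
   vertices, Y_i for the sum of y over the pendants at i, and u = x + Y.  Let D
   be the distance matrix of the cycle, A its entrywise square, and S the sum of
   coordinates.  The quadratic form of Delta at (x, y) is
     uAu + 4 Y.Du + 2 S(u) S(Y) + 2 S(Y)^2 - 4 |y|^2.
   It is negative definite on the l-dimensional space where y is free and
   u = - S(y) / q^2 is constant, since D 1 = q^2 1 and A 1 <= q^3 1.
   Let L be the Laplacian of the cycle and P the antipodal map: then
   DL = 2 (P - 1) and AL = 4q P - 2J.  On the 2q-dimensional space u = Lz + S(z),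
   y_(i,k) = ((P - 1) z)_i, the form is at least
   4q (Lz.Pz + |(P - 1) z|^2) once s >= q, and this is nonnegative by AM-GM.
   These complementary dimensions determine the inertia, by the spectral
   theorem over R[i]. *)

(** * Linear algebra preliminaries: root counting, ranks, similarity *)

Lemma sum_count_mem (T : eqType) (P : pred T) (r s : seq T) :
  uniq r -> {subset s <= r} ->
  (\sum_(x <- r | P x) count_mem x s = count P s)%N.
Proof.
move=> ur; elim: s => [|y s IHs] sub; first by rewrite big1.
rewrite /= -IHs; last by move=> x xs; apply: sub; rewrite inE xs orbT.
rewrite big_split /=; congr addn.
rewrite big_mkcond (bigD1_seq y) ?sub ?mem_head //= eqxx big1 ?addn0.
  by case: (P y).
by move=> x /negPf xy; rewrite eq_sym xy if_same.
Qed.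

(** [rootsR] lists each distinct root once and [mup] restores its multiplicity, which for a split
    polynomial is its number of occurrences in [s]. *)
Lemma neg_inertia_count (R : rcfType) n (M : 'M[R]_n) (s : seq R) :
  char_poly M = \prod_(x <- s) ('X - x%:P) ->
  neg_inertia M = count (fun x => x < 0) s.
Proof.
move=> cM; rewrite /neg_inertia /= cM.
have p0 : \prod_(x <- s) ('X - x%:P) != 0 :> {poly R}.
  by rewrite monic_neq0 // monic_prod_XsubC.
under eq_bigr do rewrite mu_prod_XsubC.
apply: sum_count_mem; first exact: uniq_roots.
by move=> x xs; rewrite -roots_on_rootsR // in_itv /= root_prod_XsubC.
Qed.

Lemma leq_rank_disjoint (F : fieldType) (a b n : nat)
    (V : 'M[F]_(a, n)) (W : 'M[F]_(b, n)) :
  (forall v : 'rV_n, (v <= V)%MS -> (v <= W)%MS -> v = 0) ->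
  (\rank V + \rank W <= n)%N.
Proof.
move=> VW; have /mxrank_disjoint_sum <- : (V :&: W)%MS = 0.
  apply/eqP; rewrite -submx0; apply/row_subP => i.
  have := row_sub i (V :&: W)%MS; rewrite sub_capmx => /andP[h1 h2].
  by rewrite (VW _ h1 h2) sub0mx.
exact: rank_leq_col.
Qed.

Lemma row_free_rowsub_unit (F : fieldType) (k n : nat) (f : 'I_k -> 'I_n)
    (P : 'M[F]_n) :
  injective f -> P \in unitmx -> row_free (rowsub f P).
Proof.
move=> finj Pu; apply/row_freeP; exists (invmx P *m (rowsub f 1%:M)^T).
rewrite mulmxA -{1}[P]mul1mx -mul_rowsub_mx mulmxK //.
apply/matrixP => i j; rewrite !mxE (bigD1 (f i)) //= !mxE eqxx mul1r big1.
  by rewrite addr0 (inj_eq finj) eq_sym.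
by move=> l /negPf li; rewrite !mxE eq_sym li mul0r.
Qed.

Lemma char_poly_similar (F : fieldType) n (P A : 'M[F]_n) :
  P \in unitmx -> char_poly (invmx P *m A *m P) = char_poly A.
Proof.
move=> Pu; rewrite /char_poly /char_poly_mx.
have -> : 'X%:M - map_mx polyC (invmx P *m A *m P) =
   map_mx polyC (invmx P) *m ('X%:M - map_mx polyC A) *m map_mx polyC P.
  rewrite !map_mxM mulmxBr mulmxBl; congr (_ - _).
  by rewrite -scalemx1 -scalemxAr mulmx1 -scalemxAl -map_mxM mulVmx // map_mx1.
by rewrite !det_mulmx mulrC mulrA -det_mulmx -map_mxM mulmxV // map_mx1 det1 mul1r.
Qed.

(** * Inertia from complementary definite subspaces, through Hermitian forms *)

Section Inertia.
Local Open Scope complex_scope.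
Local Open Scope sesquilinear_scope.
Variable R : rcfType.
Implicit Types n k : nat.

Definition qform n (M : 'M[R]_n) (v : 'rV[R]_n) : R := (v *m M *m v^T) 0 0.

Definition hform n (A : 'M[R[i]]_n) (v : 'rV[R[i]]_n) : R[i] :=
  (v *m A *m v^t*) 0 0.

Local Notation toC := (map_mx (real_complex R)).

Lemma Re_sum (I : Type) (r : seq I) (P : pred I) (F : I -> R[i]) :
  complex.Re (\sum_(i <- r | P i) F i) = \sum_(i <- r | P i) complex.Re (F i).
Proof. by apply: (big_morph (@complex.Re R)) => // [[a b] [c d]]. Qed.

Lemma qform_sum n (M : 'M[R]_n) (v : 'rV[R]_n) :
  qform M v = \sum_i \sum_j v 0 i * M i j * v 0 j.
Proof.
rewrite /qform !mxE exchange_big /=; apply: eq_bigr => j _.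
by rewrite !mxE mulr_suml.
Qed.

(** The cross terms of (a + bi)(c - di) are purely imaginary, so a real matrix sees the real and
    imaginary parts of [u] separately. *)
Lemma Re_hform n (M : 'M[R]_n) (u : 'rV[R[i]]_n) :
  complex.Re (hform (toC M) u) =
  qform M (map_mx (@complex.Re R) u) + qform M (map_mx (@complex.Im R) u).
Proof.
rewrite !qform_sum -big_split /= /hform !mxE Re_sum.
under [RHS]eq_bigr do rewrite -big_split.
rewrite [RHS]exchange_big /=.
apply: eq_bigr => j _; rewrite !mxE mulr_suml Re_sum.
apply: eq_bigr => i _; rewrite !mxE /=.
by case: (u 0 i) (u 0 j) => [a b] [c d] /=; ring.
Qed.

Lemma Re_hform_diag n (l : 'I_n -> R) (u : 'rV[R[i]]_n) :
  complex.Re (hform (diag_mx (\row_i (l i)%:C)) u) =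
  \sum_i l i * (complex.Re (u 0 i) ^+ 2 + complex.Im (u 0 i) ^+ 2).
Proof.
rewrite /hform mxE Re_sum; apply: eq_bigr => i _.
rewrite mul_mx_diag !mxE.
by case: (u 0 i) => [a b] /=; ring.
Qed.

Lemma hform_mul n k (A : 'M[R[i]]_n) (N : 'M[R[i]]_(k, n)) (u : 'rV[R[i]]_k) :
  hform A (u *m N) = hform (N *m A *m N^t*) u.
Proof. by rewrite /hform trmx_mul map_mxM !mulmxA. Qed.

Lemma toC_adj n k (N : 'M[R]_(k, n)) : (toC N)^t* = toC N^T.
Proof. by apply/matrixP=> i j; rewrite !mxE; exact: conjc_real. Qed.

(** Over [R[i]] a real symmetric matrix is Hermitian, hence normal and unitarily diagonalisable, and
    its eigenvalues are real. *)
Lemma real_spectral n (M : 'M[R]_n) : M^T = M ->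
  exists (P : 'M[R[i]]_n) (l : 'I_n -> R), P \is unitarymx /\
    toC M = invmx P *m diag_mx (\row_i (l i)%:C) *m P.
Proof.
move=> Msym; have herm : toC M \is hermsymmx.
  apply/is_hermitianmxP; rewrite expr0 scale1r -[in LHS]Msym.
  by rewrite [RHS]toC_adj.
exists (spectralmx (toC M)), (fun i => complex.Re (spectral_diag (toC M) 0 i)).
split; first exact: spectral_unitarymx.
have -> : \row_i (complex.Re (spectral_diag (toC M) 0 i))%:C =
    spectral_diag (toC M).
  apply/rowP => i; rewrite mxE RRe_real //.
  by move/mxOverP: (hermitian_spectral_diag_real herm) => ->.
exact/orthomx_spectralP/hermitian_normalmx.
Qed.

(** The k-dimensional negative space meets the span of eigenvectors with l >= 0 trivially, so at
    least k eigenvalues are negative. The m-dimensional nonnegative space meets the span of those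
    with l < 0 trivially, so at most n - m = k are. *)
Theorem neg_inertia_subspaces n k m (M : 'M[R]_n)
    (N : 'M[R]_(k, n)) (P : 'M[R]_(m, n)) :
  M^T = M -> (k + m = n)%N ->
  (forall u : 'rV_k, u != 0 -> qform M (u *m N) < 0) ->
  row_free P -> (forall u : 'rV_m, 0 <= qform M (u *m P)) ->
  neg_inertia M = k.
Proof.
move=> Msym kmn Nneg Pfree Ppos.
have [U [l [Uu Meq]]] := real_spectral Msym.
have Uunit := unitarymx_unit Uu.
have cM : char_poly M = \prod_(x <- [seq l i | i <- enum 'I_n]) ('X - x%:P).
  apply: (map_poly_inj (real_complex R)).
  rewrite map_char_poly Meq char_poly_similar // char_poly_trig; last first.
    by rewrite diag_mx_is_trig.
  rewrite rmorph_prod big_map big_enum /=; apply: eq_bigr => i _.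
  by rewrite !mxE eqxx mulr1n rmorphB /= map_polyX map_polyC.
rewrite (neg_inertia_count cM) count_map.
pose S : pred 'I_n := fun i => l i < 0.
pose Sc : pred 'I_n := fun i => ~~ S i.
have -> : count (preim l (fun x => x < 0)) (enum 'I_n) = #|S|.
  by rewrite enumT cardE /enum_mem size_filter.
have formU (u : 'rV_n) : complex.Re (hform (toC M) (u *m U)) =
    \sum_i l i * (complex.Re (u 0 i) ^+ 2 + complex.Im (u 0 i) ^+ 2).
  rewrite hform_mul -Re_hform_diag Meq; congr (complex.Re (hform _ _)).
  by rewrite !mulmxA mulmxV // mul1mx -mulmxA (unitarymxP Uu) mulmx1.
(* Since U M = diag(l) U, the rows of [U] are eigenvectors; [E A] spans those with index in [A]. *)
pose E (A : pred 'I_n) := rowsub (enum_val : 'I_#|A| -> 'I_n) U.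
have rankE A : \rank (E A) = #|A|.
  apply/eqP; apply: row_free_rowsub_unit => //; exact: enum_val_inj.
have supp (A : pred 'I_n) v : (v <= E A)%MS ->
    exists2 u : 'rV_n, v = u *m U & forall i, ~~ A i -> u 0 i = 0.
  move=> /submxP[w ->]; exists (w *m rowsub (enum_val : 'I_#|A| -> 'I_n) 1%:M).
    by rewrite -mulmxA mul_rowsub_mx mul1mx.
  move=> i Ai; rewrite !mxE big1 // => j _; rewrite !mxE.
  case: eqP => [ij|_]; last by rewrite mulr0.
  by case/negP: Ai; rewrite -ij; exact: (enum_valP j).
(* A nonzero row in the kernel of [N] would give the form the value 0, against definiteness. *)
have rankN : \rank (toC N) = k.
  rewrite mxrank_map; apply/eqP; rewrite -/(row_free N) -kermx_eq0.
  apply/eqP/row_matrixP => i; rewrite row0; apply/eqP.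
  apply/negPn/negP => /Nneg; rewrite -row_mul mulmx_ker row0.
  by rewrite /qform !mul0mx mxE ltxx.
have rankP : \rank (toC P) = m by rewrite mxrank_map; exact/eqP.
have form_mul p (B : 'M[R]_(p, n)) (u : 'rV_p) :
    complex.Re (hform (toC M) (u *m toC B)) =
    qform M (map_mx (@complex.Re R) u *m B) +
    qform M (map_mx (@complex.Im R) u *m B).
  rewrite hform_mul toC_adj -!map_mxM Re_hform /qform.
  by rewrite !trmx_mul !mulmxA.
have rank_neg : (\rank (toC N) + \rank (E Sc) <= n)%N.
  apply: leq_rank_disjoint => v /submxP[u uv] /supp[w wv wS].
  move: uv; have [->|u0 uv] := eqVneq u 0; first by rewrite mul0mx.
  suff : complex.Re (hform (toC M) v) < 0.
    rewrite ltNge wv formU sumr_ge0 // => i _.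
    have [Si|Si] := boolP (S i); first by rewrite wS ?negbK //= expr0n /= addr0 mulr0.
    by rewrite mulr_ge0 ?addr_ge0 ?sqr_ge0 // leNgt.
  (* Neither the real nor the imaginary part of [u] contributes positively, and a nonzero one
     contributes strictly negatively. *)
  have wle (x : 'rV[R]_k) : qform M (x *m N) <= 0.
    have [->|x0] := eqVneq x 0; last exact/ltW/Nneg.
    by rewrite /qform !mul0mx mxE.
  rewrite uv form_mul.
  have [re0|/Nneg re0] := eqVneq (map_mx (@complex.Re R) u) 0; last first.
    by have := wle (map_mx (@complex.Im R) u); lra.
  have [im0|/Nneg im0] := eqVneq (map_mx (@complex.Im R) u) 0; last first.
    by have := wle (map_mx (@complex.Re R) u); lra.
  case/eqP: u0; apply/rowP => i; rewrite mxE.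
  move/rowP/(_ i): re0; move/rowP/(_ i): im0; rewrite !mxE.
  by case: (u 0 i) => a b /= -> ->.
have rank_nonneg : (\rank (toC P) + \rank (E S) <= n)%N.
  apply: leq_rank_disjoint => v /submxP[u uv] /supp[w wv wS].
  have : 0 <= complex.Re (hform (toC M) v) by rewrite uv form_mul addr_ge0.
  rewrite wv formU => pos; suff -> : w = 0 by rewrite mul0mx.
  (* A nonnegative sum of nonpositive terms has all terms zero, and l i < 0 then forces w i = 0. *)
  have neg i : 0 <= - (l i * (complex.Re (w 0 i) ^+ 2 + complex.Im (w 0 i) ^+ 2)).
    have [Si|Si] := boolP (S i); last by rewrite wS //= expr0n /= addr0 mulr0 oppr0.
    by rewrite oppr_ge0 mulr_le0_ge0 ?addr_ge0 ?sqr_ge0 // ltW.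
  have z : \sum_i - (l i * (complex.Re (w 0 i) ^+ 2 + complex.Im (w 0 i) ^+ 2)) = 0.
    by apply/eqP; rewrite eq_le sumr_ge0 // andbT sumrN oppr_le0.
  apply/rowP => i; rewrite mxE.
  have [Si|Si] := boolP (S i); last exact: wS.
  move: (psumr_eq0P (fun i _ => neg i) z) => /(_ i isT)/eqP.
  rewrite oppr_eq0 mulf_eq0 lt_eqF //= paddr_eq0 ?sqr_ge0 // !sqrf_eq0.
  by case: (w 0 i) => a b /= /andP[/eqP-> /eqP->].
rewrite rankN rankE in rank_neg; rewrite rankP rankE in rank_nonneg.
have cS : (#|S| + #|Sc| = n)%N.
  by rewrite -[RHS]card_ord -(cardC S); congr addn; apply: eq_card.
by move: rank_neg rank_nonneg cS; clear -kmn; lia.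
Qed.

End Inertia.

(** The same criterion with vectors read as functions on [T], so that later computations never meet
    the enumeration of the vertices. *)
Lemma neg_inertia_forms (R : rcfType) (T : finType) k m (K : T -> T -> R)
    (f : 'rV[R]_k -> T -> R) (g : 'rV[R]_m -> T -> R) :
  (forall a b, K a b = K b a) -> (k + m = #|T|)%N ->
  (forall c u v t, f (c *: u + v) t = c * f u t + f v t) ->
  (forall c u v t, g (c *: u + v) t = c * g u t + g v t) ->
  (forall u, u != 0 -> \sum_a \sum_b f u a * K a b * f u b < 0) ->
  (forall u, 0 <= \sum_a \sum_b g u a * K a b * g u b) ->
  (forall u, (forall t, g u t = 0) -> u = 0) ->
  neg_inertia (\matrix_(i, j) K (enum_val i) (enum_val j) : 'M[R]_#|T|) = k.
Proof.
move=> Ksym kmT flin glin fneg gpos ginj.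
set M := \matrix_(i, j) _.
pose row_of p (h : 'rV[R]_p -> T -> R) u := \row_i h u (enum_val i) : 'rV[R]_#|T|.
have row_lin p (h : 'rV[R]_p -> T -> R) :
    (forall c u v t, h (c *: u + v) t = c * h u t + h v t) -> linear (row_of p h).
  by move=> hlin c u v; apply/rowP => i; rewrite !mxE hlin.
have formE p (h : 'rV[R]_p -> T -> R) u :
    qform M (row_of p h u) = \sum_a \sum_b h u a * K a b * h u b.
  have bij : {on predT, bijective (enum_val : 'I_#|T| -> T)}.
    exact/onW_bij/enum_val_bij.
  rewrite qform_sum [RHS](reindex _ bij) /=; apply: eq_bigr => i _.
  by rewrite [RHS](reindex _ bij) /=; apply: eq_bigr => j _; rewrite !mxE.
pose F : {linear 'rV[R]_k -> 'rV[R]_#|T|} :=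
  HB.pack (row_of k f) (GRing.isLinear.Build _ _ _ _ _ (row_lin k f flin)).
pose G : {linear 'rV[R]_m -> 'rV[R]_#|T|} :=
  HB.pack (row_of m g) (GRing.isLinear.Build _ _ _ _ _ (row_lin m g glin)).
apply: (neg_inertia_subspaces (N := lin1_mx F) (P := lin1_mx G)) => //.
- by apply/matrixP => i j; rewrite !mxE Ksym.
- by move=> u u0; rewrite mul_rV_lin1 /= formE; exact: fneg.
- rewrite -kermx_eq0; apply/eqP/row_matrixP => i; rewrite row0.
  apply: ginj => t; have : row i (kermx (lin1_mx G)) *m lin1_mx G = 0.
    by rewrite -row_mul mulmx_ker row0.
  rewrite mul_rV_lin1 /= => /rowP/(_ (enum_rank t)).
  by rewrite !mxE enum_rankK.
- by move=> u; rewrite mul_rV_lin1 /= formE; exact: gpos.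
Qed.

(** * Distance on the cycle of length 2q *)

Section CycleDistance.
Variable q : nat.
(** With truncated subtraction, (i - j) + (j - i) is the absolute difference, the length of one of
    the two arcs. *)
Definition cdist (i j : nat) : nat :=
  let d := ((i - j) + (j - i))%N in minn d (2 * q - d).

Lemma cdistC i j : cdist i j = cdist j i.
Proof. by rewrite /cdist addnC. Qed.

Lemma cdistii i : cdist i i = 0%N.
Proof. by rewrite /cdist; lia. Qed.

Lemma cdist_eq0 (i j : 'I_(2 * q)) : cdist i j = 0%N -> i = j.
Proof.
by have := ltn_ord i; have := ltn_ord j => ? ? h; apply: val_inj; move: h;
  rewrite /cdist /=; lia.
Qed.

Lemma cdist_le i j : (cdist i j <= q)%N.
Proof. by rewrite /cdist; lia. Qed.

Hypothesis q_gt0 : (0 < q)%N.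

Fact antipode_subproof (i : 'I_(2 * q)) : ((i + q) %% (2 * q) < 2 * q)%N.
Proof. by rewrite ltn_mod muln_gt0. Qed.
Definition antipode (i : 'I_(2 * q)) : 'I_(2 * q) :=
  Ordinal (antipode_subproof i).

Lemma val_ordS (i : 'I_(2 * q)) :
  ordS i = (if i.+1 == (2 * q)%N then 0 else i.+1)%N :> nat.
Proof.
rewrite /=; case: eqP => [->|ne]; first by rewrite modnn.
by rewrite modn_small // ltn_neqAle ltn_ord andbT; apply/eqP.
Qed.

Lemma val_ord_pred (i : 'I_(2 * q)) :
  ord_pred i = (if i == 0 :> nat then (2 * q).-1 else i.-1)%N :> nat.
Proof.
rewrite /=; have := ltn_ord i; case: eqP => [->|ne] lt.
  by rewrite add0n modn_small //; lia.
have -> : ((i + 2 * q).-1 = i.-1 + 2 * q)%N by lia.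
by rewrite modnDr modn_small //; lia.
Qed.

Lemma val_antipode (i : 'I_(2 * q)) :
  antipode i = (if i < q then i + q else i - q)%N :> nat.
Proof.
rewrite /=; have := ltn_ord i; case: (ltnP i q) => iq lt.
  by rewrite modn_small //; lia.
have -> : (i + q = (i - q) + 2 * q)%N by lia.
by rewrite modnDr modn_small //; lia.
Qed.

Lemma antipodeK : involutive antipode.
Proof.
move=> i; apply: val_inj; rewrite /= -/(val (antipode i)).
have := val_antipode (antipode i); have := val_antipode i.
by have := ltn_ord i; case: ifP; case: ifP => /=; lia.
Qed.

(** Every vertex [i] lies on a shortest path from [j] to its antipode. *)
Lemma cdist_antipode (i j : 'I_(2 * q)) :
  (cdist i j + cdist i (antipode j) = q)%N.
Proof.
have := ltn_ord i; have := ltn_ord j; rewrite /cdist val_antipode.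
by case: ifP => *; lia.
Qed.

(** Local shape of the distance from [i] at [j] and its two neighbours: a minimum at [i], a maximum
    q at the antipode, slope 1 or -1 elsewhere. *)
Variant cdist_neighbours_spec (i j : 'I_(2 * q)) :
    nat -> nat -> nat -> bool -> bool -> Prop :=
| CdistEq : cdist_neighbours_spec i j 0 1 1 true false
| CdistAnti : cdist_neighbours_spec i j q q.-1 q.-1 false true
| CdistUp d : cdist_neighbours_spec i j d.+1 d d.+2 false false
| CdistDown d : cdist_neighbours_spec i j d.+1 d.+2 d false false.

Lemma cdist_neighbours (i j : 'I_(2 * q)) :
  cdist_neighbours_spec i j (cdist i j) (cdist i (ord_pred j))
    (cdist i (ordS j)) (i == j) (j == antipode i).
Proof.
have ltI := ltn_ord i; have ltJ := ltn_ord j.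
have eqE (x y : 'I_(2 * q)) : (x == y) = (x == y :> nat) by [].
rewrite !eqE val_antipode.
have vS := val_ordS j; have vP := val_ord_pred j.
have [e|ne] := eqVneq (i : nat) j.
  have -> : cdist i j = 0%N by rewrite /cdist; lia.
  have -> : cdist i (ord_pred j) = 1%N.
    by move: vP; rewrite /cdist; case: ifP => ? ->; lia.
  have -> : cdist i (ordS j) = 1%N.
    by move: vS; rewrite /cdist; case: ifP => ? ->; lia.
  have -> : (j == (if (i < q)%N then (i + q)%N else (i - q)%N) :> nat) = false.
    by case: ifP => *; lia.
  by constructor.
have [e|ne'] := eqVneq (j : nat) (if (i < q)%N then (i + q)%N else (i - q)%N).
  have -> : cdist i j = q by move: e; rewrite /cdist; case: ifP => *; lia.
  have -> : cdist i (ord_pred j) = q.-1.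
    by move: vP e; rewrite /cdist; case: ifP => ? ->; case: ifP => *; lia.
  have -> : cdist i (ordS j) = q.-1.
    by move: vS e; rewrite /cdist; case: ifP => ? ->; case: ifP => *; lia.
  by constructor.
have h : (cdist i j = (cdist i j).-1.+1)%N by rewrite /cdist; lia.
(* The first case is the open half-cycle that follows [i], the second the one that precedes it; each
   is split where the indices wrap around. *)
have [up|dn] : ((i < j) && (j < i + q) || (j + q < i) \/
                (j < i) && (i < j + q) || (i + q < j))%N.
- by move: ne ne'; case: ifP => *; lia.
- have -> : cdist i (ord_pred j) = (cdist i j).-1.
    by rewrite /cdist vP; case: ifP => *; lia.
  have -> : cdist i (ordS j) = (cdist i j).-1.+2.
    by rewrite /cdist vS; case: ifP => *; lia.
  by rewrite h /=; constructor.
- have -> : cdist i (ord_pred j) = (cdist i j).-1.+2.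
    by rewrite /cdist vP; case: ifP => *; lia.
  have -> : cdist i (ordS j) = (cdist i j).-1.
    by rewrite /cdist vS; case: ifP => *; lia.
  by rewrite h /=; constructor.
Qed.

End CycleDistance.

(** * A criterion for recognising the graph distance *)

Section GraphDistance.
Variables (T : finType) (e : rel T) (d : T -> T -> nat).
Hypothesis d_refl : forall x, d x x = 0%N.
Hypothesis d_eq0 : forall x y, d x y = 0%N -> x = y.
Hypothesis d_step : forall x w z, e w z -> (d x z <= (d x w).+1)%N.
Hypothesis d_pred :
  forall x z m, d x z = m.+1 -> exists2 w, e w z & d x w = m.

(** Induction on [n]: [d_step] limits what one expansion can reach, and [d_pred] shows that
    everything one step further is reached. *)
Lemma mem_gball x y n : (y \in gball e x n) = (d x y <= n)%N.
Proof.
elim: n y => [|n IHn] y.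
  rewrite inE leqn0; apply/eqP/eqP => [->|/d_eq0 //]; exact: d_refl.
rewrite /gball iterS -/(gball e x n) !inE IHn.
apply/orP/idP => [[/leqW //|/existsP[w /andP[]]]|].
  by rewrite IHn => dw /(d_step x) /leq_trans; apply.
rewrite leq_eqVlt => /orP[/eqP /d_pred[w ewy dw]|]; last by left.
by right; apply/existsP; exists w; rewrite IHn dw leqnn.
Qed.

(** The bound on [d x y] keeps the first hit inside the searched range; the range is cut at [d x y],
    with no hit before the cut and one right at it. *)
Lemma gdistE x y : (d x y < #|T|)%N -> gdist e x y = d x y.
Proof.
move=> dT; rewrite /gdist (eq_find (a2 := leq (d x y))); last first.
  by move=> n; rewrite mem_gball.
rewrite -(subnKC (ltnW dT)) iotaD find_cat add0n size_iota.
rewrite ifN; last first.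
  by apply/hasPn => n; rewrite mem_iota add0n -ltnNge => /andP[].
by case: (_ - _)%N (subn_gt0 (d x y) #|T|) => [|n] /=; rewrite ?dT // leqnn addn0.
Qed.

End GraphDistance.

(** * Distance in the cycle with pendant vertices *)

Section SunDistance.
Variables q s : nat.
Hypothesis q_gt1 : (1 < q)%N.

Definition ubase (a : Uvert q s) : 'I_(2 * q) :=
  match a with inl i => i | inr p => p.1 end.
Definition uheight (a : Uvert q s) : nat :=
  match a with inl _ => 0%N | inr _ => 1%N end.
(** Each pendant end adds one edge to the cycle path; the diagonal is separate because a pendant
    would get 2 there. *)
Definition udist (a b : Uvert q s) : nat :=
  (if a == b then 0 else cdist q (ubase a) (ubase b) + (uheight a + uheight b))%N.

Lemma udistC a b : udist a b = udist b a.
Proof. by rewrite /udist eq_sym cdistC; case: eqP => // _; lia. Qed.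

Lemma cdist_adj (i j k : 'I_(2 * q)) : Uadj (q := q) (s := s) (inl j) (inl k) ->
  (cdist q i k <= (cdist q i j).+1)%N.
Proof.
have q_gt0 := ltnW q_gt1.
move=> /orP[/eqP jk|/eqP kj].
  have -> : k = ordS j by apply: val_inj.
  by case: (cdist_neighbours q_gt0 i j) => *; lia.
have -> : j = ordS k by apply: val_inj.
by case: (cdist_neighbours q_gt0 i k) => *; lia.
Qed.

Lemma cdist_pred (i j : 'I_(2 * q)) m : cdist q i j = m.+1 ->
  exists2 k : 'I_(2 * q), Uadj (q := q) (s := s) (inl k) (inl j) & cdist q i k = m.
Proof.
have q_gt0 := ltnW q_gt1.
have aS : Uadj (q := q) (s := s) (inl (ordS j)) (inl j) by rewrite /= eqxx orbT.
have aP : Uadj (q := q) (s := s) (inl (ord_pred j)) (inl j).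
  by apply/orP; left; rewrite -[X in _ == val X]ord_predK.
move=> E.
have [dS|dP] : cdist q i (ordS j) = m \/ cdist q i (ord_pred j) = m.
- by move: E; case: (cdist_neighbours q_gt0 i j) => *; lia.
- by exists (ordS j).
- by exists (ord_pred j).
Qed.

Lemma gdist_Uadj (a b : Uvert q s) : gdist (Uadj (q := q) (s := s)) a b = udist a b.
Proof.
have q_gt0 := ltnW q_gt1.
apply: gdistE => [x|x y|x w z|x z m|].
- by rewrite /udist eqxx.
- rewrite /udist; case: eqP => // _; case: x y => [i|[i k]] [j|[j l]] /=; try lia.
  by rewrite !addn0 => /cdist_eq0 ->.
- have [->|nxw] := eqVneq x w.
    rewrite {2}/udist eqxx /udist; case: eqP => // _.
    case: w z => [i|[i k]] [j|[j l]] //=.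
    + by move=> /(cdist_adj i); rewrite cdistii; lia.
    + by move=> /eqP ->; rewrite cdistii.
    + by move=> /eqP ->; rewrite cdistii.
  rewrite /udist (negPf nxw); case: eqP => // _.
  case: w z {nxw} => [i|[i k]] [j|[j l]] //=.
  + by move=> /(cdist_adj (ubase x)); lia.
  + by move=> /eqP ->; lia.
  + by move=> /eqP ->; lia.
(* The nearer neighbour of a cycle vertex is the pendant [x] itself when [x] hangs there, and a
   cycle vertex otherwise; that of a pendant is its base. *)
- case: z => [j|[j l]] /=.
    have [->|nx] := eqVneq x (inl j); first by rewrite /udist eqxx.
    rewrite {1}/udist (negPf nx) /= addn0.
    case: x nx => [i|[i k]] nx /=.
      rewrite !addn0 => /cdist_pred[w wj dw]; exists (inl w) => //.
      rewrite /udist /= !addn0 dw; case: eqP => [iw|] //.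
      by case: iw dw => ->; rewrite cdistii.
    have [ij|nij] := eqVneq i j.
      rewrite ij cdistii => -[<-]; exists (inr (j, k)); first by rewrite /= eqxx.
      by rewrite /udist eqxx.
    rewrite addn1 => -[<-].
    case E : (cdist q i j) => [|m']; first by rewrite (cdist_eq0 E) eqxx in nij.
    have [w wj dw] := cdist_pred E; exists (inl w) => //.
    by rewrite /udist /= dw addn1.
  have [->|nx] := eqVneq x (inr (j, l)); first by rewrite /udist eqxx.
  rewrite {1}/udist (negPf nx) /= => E; exists (inl j) => /=; first by rewrite eqxx.
  rewrite /udist; case: eqP => [xj|_] /=; last by lia.
  by move: E; rewrite xj /= cdistii => -[].
(* The distance is at most q + 2 and there are 2q + 2qs vertices; a pendant among [a], [b] gives s >
   0. *)
- rewrite /udist card_sum card_prod !card_ord; case: eqP => [_|ne]; first by lia.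
  have := cdist_le q (ubase a) (ubase b).
  case: a b ne => [i|[i k]] [j|[j l]] /= ne; have := ltn_ord i; first by lia.
  all: have := ltn_ord i; try have := ltn_ord k; try have := ltn_ord l; nia.
Qed.
End SunDistance.

(** * The quadratic form of the squared distances *)

Section SunForm.
Variables (R : rcfType) (q s : nat).
Hypothesis q_gt1 : (1 < q)%N.
Let q_gt0 : (0 < q)%N := ltnW q_gt1.
Local Notation I := 'I_(2 * q).
Local Notation V := (Uvert q s).
Local Notation anti := (antipode q_gt0).

Definition cd (i j : I) : R := (cdist q i j)%:R.
Definition lap (z : I -> R) (i : I) : R := 2 * z i - z (ordS i) - z (ord_pred i).

Lemma sum_ordS (F : I -> R) : \sum_i F (ordS i) = \sum_i F i.
Proof. by rewrite [RHS](reindex_inj (@ordS_inj _)). Qed.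

Lemma sum_ord_pred (F : I -> R) : \sum_i F (ord_pred i) = \sum_i F i.
Proof. by rewrite [RHS](reindex_inj (@ord_pred_inj _)). Qed.

Lemma sum_antipode (F : I -> R) : \sum_i F (anti i) = \sum_i F i.
Proof. by rewrite [RHS](reindex_inj (inv_inj (antipodeK q_gt0))). Qed.

(** Self-adjointness of the Laplacian, by shifting the index in the two neighbour terms. *)
Lemma sum_mul_lap (f z : I -> R) :
  \sum_j f j * lap z j = \sum_j lap f j * z j.
Proof.
pose G j := 2 * f j * z j - f (ord_pred j) * z j - f (ordS j) * z j.
transitivity (\sum_j G j); last by apply: eq_bigr => j _; rewrite /G /lap; ring.
rewrite /G !sumrB -(sum_ordS (fun j => f (ord_pred j) * z j)).
rewrite -(sum_ord_pred (fun j => f (ordS j) * z j)) -!sumrB.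
by apply: eq_bigr => j _; rewrite ordSK ord_predK /lap; ring.
Qed.

Lemma sum_lap (z : I -> R) : \sum_j lap z j = 0.
Proof.
under eq_bigr do rewrite -[lap z _]mul1r.
rewrite sum_mul_lap big1 // => j _.
by rewrite /lap; ring.
Qed.

Lemma sum_pick (z : I -> R) i : \sum_j (i == j)%:R * z j = z i.
Proof.
rewrite (bigD1 i) //= eqxx mul1r big1 ?addr0 // => j ji.
by rewrite eq_sym (negPf ji) mul0r.
Qed.

(** The distance from [i] is linear along the cycle except for kinks at [i] and at its antipode. *)
Lemma lap_cd i j : lap (cd i) j = 2 * (anti i == j)%:R - 2 * (i == j)%:R.
Proof.
rewrite /lap /cd [anti i == j]eq_sym.
case: (cdist_neighbours q_gt0 i j) => [||d|d] /=; try ring.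
have -> : (q%:R : R) = q.-1%:R + 1 by rewrite natr1 prednK.
by ring.
Qed.

(** On a linear stretch 2d^2 - (d-1)^2 - (d+1)^2 = -2, which is also the value at [i]; at the
    antipode 2q^2 - 2(q-1)^2 = 4q - 2. *)
Lemma lap_cd_sq i j :
  lap (fun j => cd i j ^+ 2) j = 4 * q%:R * (anti i == j)%:R - 2.
Proof.
rewrite /lap /cd [anti i == j]eq_sym.
case: (cdist_neighbours q_gt0 i j) => [||d|d] /=; try ring.
have -> : (q%:R : R) = q.-1%:R + 1 by rewrite natr1 prednK.
by ring.
Qed.

Lemma sum_cd_lap z i : \sum_j cd i j * lap z j = 2 * (z (anti i) - z i).
Proof.
rewrite sum_mul_lap; under eq_bigr do rewrite lap_cd mulrBl -!mulrA.
by rewrite sumrB -!mulr_sumr !sum_pick; ring.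
Qed.

Lemma sum_cd_sq_lap z i :
  \sum_j cd i j ^+ 2 * lap z j = 4 * q%:R * z (anti i) - 2 * \sum_j z j.
Proof.
rewrite sum_mul_lap; under eq_bigr do rewrite lap_cd_sq mulrBl -[_ * z _]mulrA.
by rewrite sumrB -!mulr_sumr sum_pick.
Qed.

Lemma sum_cycle_const (c : R) : \sum_(i : I) c = 2 * q%:R * c.
Proof. by rewrite sumr_const card_ord -[_ *+ (2 * q)]mulr_natl natrM. Qed.

(** Pairing each [j] with its antipode gives 2q pairs of sum q, and counts the sum twice. *)
Lemma sum_cd i : \sum_j cd i j = q%:R ^+ 2.
Proof.
have : \sum_j cd i j + \sum_j cd i j = 2 * q%:R * q%:R.
  rewrite -{2}(sum_antipode (cd i)) -big_split -sum_cycle_const /=.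
  by apply: eq_bigr => j _; rewrite /cd -natrD cdist_antipode.
by move=> h; lra.
Qed.

Lemma sum_cd_sq_le i : \sum_j cd i j ^+ 2 <= q%:R ^+ 3.
Proof.
rewrite exprS -(sum_cd i) mulr_sumr; apply: ler_sum => j _.
by rewrite expr2 ler_wpM2r ?ler0n // ler_nat cdist_le.
Qed.

Lemma cdC i j : cd i j = cd j i. Proof. by rewrite /cd cdistC. Qed.

Lemma sum_Uvert (G : V -> R) :
  \sum_a G a = \sum_i G (inl i) + \sum_i \sum_k G (inr (i, k)).
Proof. by rewrite big_sumType /= pair_bigA /=; congr (_ + _); apply: eq_bigr => -[]. Qed.

(* [pend v] and [tot v] are the Y and u of the header, [lap] is L and [cd] is D. *)
Definition pend (v : V -> R) (i : I) : R := \sum_k v (inr (i, k)).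
Definition tot (v : V -> R) (i : I) : R := v (inl i) + pend v i.

(** A weight that depends only on base and height collapses to a sum over the cycle. *)
Lemma sum_weight v (F G : I -> R) :
  \sum_a v a * (F (ubase a) + (uheight a)%:R * G (ubase a)) =
  \sum_i (tot v i * F i + pend v i * G i).
Proof.
rewrite sum_Uvert -big_split; apply: eq_bigr => i _ /=.
by rewrite -mulr_suml /tot /pend; ring.
Qed.

(** The square of d + h_a + h_b, expanded with h^2 = h since heights are 0 or 1. The last term
    removes the value 4 that this gives when a = b is a pendant. *)
Lemma udist_sq a b : ((udist (q := q) (s := s) a b ^ 2)%:R : R) =
  (cd (ubase a) (ubase b) ^+ 2 + (uheight a)%:R * (2 * cd (ubase a) (ubase b) + 1))
  + (uheight b)%:R * (2 * cd (ubase a) (ubase b) + 1 + 2 * (uheight a)%:R)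
  - 4 * ((a == b)%:R * (uheight a)%:R).
Proof.
rewrite /udist; case: eqP => [<-|ne]; rewrite natrX ?natrD /cd ?cdistii.
  by case: a => [i|p] /=; ring.
by case: a {ne} => [i|p]; case: b => [j|p'] /=; ring.
Qed.

Lemma sun_form v :
  \sum_a \sum_b v a * (udist (q := q) (s := s) a b ^ 2)%:R * v b =
  \sum_(i : I) tot v i * (\sum_(j : I) cd i j ^+ 2 * tot v j)
  + 4 * \sum_(i : I) pend v i * (\sum_(j : I) cd i j * tot v j)
  + 2 * (\sum_(i : I) tot v i) * (\sum_(i : I) pend v i)
  + 2 * (\sum_(i : I) pend v i) ^+ 2
  - 4 * \sum_(i : I) \sum_k v (inr (i, k)) ^+ 2.
Proof.
(* Without the diagonal correction, the matrix row of a vertex over [i] paired with [v] is F i, plus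
   G i if the vertex is pendant. *)
pose F i := \sum_(j : I) (tot v j * cd i j ^+ 2 + pend v j * (2 * cd i j + 1)).
pose G i := \sum_(j : I) (tot v j * (2 * cd i j + 1) + pend v j * 2).
transitivity (\sum_a v a * (F (ubase a) + (uheight a)%:R * G (ubase a))
              - 4 * \sum_a (uheight a)%:R * v a ^+ 2).
  rewrite mulr_sumr -sumrB; apply: eq_bigr => a _.
  have -> : (uheight a)%:R * v a ^+ 2 =
      \sum_b (a == b)%:R * ((uheight a)%:R * v a * v b).
    rewrite (bigD1 a) //= eqxx big1 /=; first by ring.
    by move=> b ba; rewrite eq_sym (negPf ba) mul0r.
  have -> : F (ubase a) + (uheight a)%:R * G (ubase a) =
     \sum_b v b * ((cd (ubase a) (ubase b) ^+ 2
                    + (uheight a)%:R * (2 * cd (ubase a) (ubase b) + 1))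
                 + (uheight b)%:R * (2 * cd (ubase a) (ubase b) + 1 + 2 * (uheight a)%:R)).
    rewrite (sum_weight v (fun j => cd (ubase a) j ^+ 2
                    + (uheight a)%:R * (2 * cd (ubase a) j + 1))
       (fun j => 2 * cd (ubase a) j + 1 + 2 * (uheight a)%:R)).
    by rewrite /F /G mulr_sumr -big_split; apply: eq_bigr => j _ /=; ring.
  rewrite !mulr_sumr -sumrB; apply: eq_bigr => b _.
  by rewrite udist_sq; case: eqP => [<-|_] /=; ring.
rewrite sum_weight big_split /=.
have -> : \sum_a (uheight a)%:R * v a ^+ 2 = \sum_(i : I) \sum_k v (inr (i, k)) ^+ 2.
  rewrite sum_Uvert big1 ?add0r; last by move=> i _; rewrite /= mul0r.
  by apply: eq_bigr => i _; apply: eq_bigr => k _; rewrite mul1r.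
congr (_ - _).
have FE i : F i = \sum_(j : I) cd i j ^+ 2 * tot v j + 2 * \sum_(j : I) cd i j * pend v j
                  + \sum_(j : I) pend v j.
  by rewrite /F mulr_sumr -!big_split; apply: eq_bigr => j _ /=; ring.
have GE i : G i = 2 * \sum_(j : I) cd i j * tot v j + \sum_(j : I) tot v j
                  + 2 * \sum_(j : I) pend v j.
  by rewrite /G !mulr_sumr -!big_split; apply: eq_bigr => j _ /=; ring.
under eq_bigr do rewrite FE !mulrDr.
under [X in _ + X]eq_bigr do rewrite GE !mulrDr.
rewrite !big_split /= -!mulr_suml.
(* By symmetry of D the two mixed terms agree, whence the coefficient 4. *)
have -> : \sum_(i : I) tot v i * (2 * \sum_(j : I) cd i j * pend v j) =
          2 * \sum_(i : I) pend v i * (\sum_(j : I) cd i j * tot v j).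
  rewrite mulr_sumr.
  under eq_bigr do rewrite !mulr_sumr.
  under [RHS]eq_bigr do rewrite !mulr_sumr.
  rewrite exchange_big; apply: eq_bigr => i _; apply: eq_bigr => j _ /=.
  by rewrite cdC; ring.
have -> : \sum_(i : I) pend v i * (2 * \sum_(j : I) cd i j * tot v j) =
          2 * \sum_(i : I) pend v i * (\sum_(j : I) cd i j * tot v j).
  by rewrite mulr_sumr; apply: eq_bigr => i _; ring.
have -> : \sum_i tot v i = \sum_i v (inl i) + \sum_i pend v i by rewrite -big_split.
by ring.
Qed.

(** With c = S(z), AL = 4qP - 2J gives A(Lz + c1) = 4q Pz - 2c1 + c A1. After pairing with Lz + c1
    the cross terms vanish, and the surplus c^2 1A1 is nonnegative. *)
Lemma cycle_form_ge z :
  4 * q%:R * (\sum_i lap z i * z (anti i)) <=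
  \sum_i (lap z i + \sum_j z j) *
     (\sum_j cd i j ^+ 2 * (lap z j + \sum_j z j)).
Proof.
set c := \sum_j z j.
have E i : \sum_j cd i j ^+ 2 * (lap z j + c) =
    4 * q%:R * z (anti i) - 2 * c + c * \sum_j cd i j ^+ 2.
  under eq_bigr do rewrite mulrDr.
  by rewrite big_split /= sum_cd_sq_lap -mulr_suml -/c; ring.
under [leRHS]eq_bigr do rewrite E.
have -> : \sum_i (lap z i + c) *
      (4 * q%:R * z (anti i) - 2 * c + c * (\sum_j cd i j ^+ 2)) =
   4 * q%:R * (\sum_i lap z i * z (anti i)) - 2 * c * (\sum_i lap z i)
   + c * (\sum_i \sum_j cd i j ^+ 2 * lap z j)
   + c * (\sum_i (4 * q%:R * z (anti i) - 2 * c))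
   + c ^+ 2 * \sum_i \sum_j cd i j ^+ 2.
  have -> : \sum_i \sum_j cd i j ^+ 2 * lap z j = \sum_i lap z i * \sum_j cd i j ^+ 2.
    rewrite exchange_big; apply: eq_bigr => i _ /=.
    by rewrite mulr_sumr; apply: eq_bigr => j _; rewrite cdC mulrC.
  rewrite !mulr_sumr -sumrB -!big_split.
  by apply: eq_bigr => i _ /=; ring.
(* This is the sum of the entries of ALz, namely 4qc - 2q * 2c; both cross terms reduce to it. *)
have cancel : \sum_i (4 * q%:R * z (anti i) - 2 * c) = 0.
  by rewrite sumrB -mulr_sumr sum_antipode -/c sum_cycle_const; ring.
under [X in _ + c * X + _ + _]eq_bigr do rewrite sum_cd_sq_lap -/c.
rewrite cancel sum_lap !mulr0 !addr0 subr0 lerDl mulr_ge0 ?sqr_ge0 //.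
by apply: sumr_ge0 => i _; apply: sumr_ge0 => j _; exact: sqr_ge0.
Qed.

(** Let b be the antipodal value and d, e the neighbouring ones. The summand is z_i^2 + b^2 - (d +
    e)b; subtracting z_i^2 - d^2/2 - e^2/2, whose total is zero, leaves ((d - b)^2 + (e -
    b)^2)/2. *)
Lemma lap_antipode_ge0 z :
  0 <= (\sum_i lap z i * z (anti i)) + \sum_i (z (anti i) - z i) ^+ 2.
Proof.
have h0 : \sum_i (z i ^+ 2 - z (ordS i) ^+ 2 / 2 - z (ord_pred i) ^+ 2 / 2) = 0.
  rewrite !sumrB -!mulr_suml (sum_ordS (fun i => z i ^+ 2)).
  by rewrite (sum_ord_pred (fun i => z i ^+ 2)); field.
rewrite -[leLHS]h0 -big_split; apply: ler_sum => i _ /=; rewrite /lap.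
have h1 := sqr_ge0 (z (ordS i) - z (anti i)).
have h2 := sqr_ge0 (z (ord_pred i) - z (anti i)).
by move: h1 h2; generalize (z i) (z (anti i)) (z (ordS i)) (z (ord_pred i));
  move=> a b d e; nra.
Qed.
End SunForm.

(** * The negative and the nonnegative subspace *)

Section SunSubspaces.
Variables (R : rcfType) (q s : nat).
Hypothesis q_gt1 : (1 < q)%N.
Let q_gt0 : (0 < q)%N := ltnW q_gt1.
Local Notation I := 'I_(2 * q).
Local Notation V := (Uvert q s).
Local Notation anti := (antipode q_gt0).
Local Notation sform v :=
  (\sum_a \sum_b v a * (udist (q := q) (s := s) a b ^ 2)%:R * v b).

(** The cycle values are solved from [tot] = - S(y) / q^2. *)
Definition neg_vec (u : 'rV[R]_#|{: I * 'I_s}|) (a : V) : R :=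
  match a with
  | inl i => - (\sum_k u 0 (enum_rank (i, k)))
             - (\sum_p u 0 (enum_rank p)) / q%:R ^+ 2
  | inr p => u 0 (enum_rank p)
  end.

(** The s equal pendants at [i] sum to the term subtracted on the cycle, which leaves [tot] = Lz +
    S(z). *)
Definition nonneg_vec (z : 'rV[R]_(2 * q)) (a : V) : R :=
  match a with
  | inl i => lap (z 0) i + \sum_j z 0 j - s%:R * (z 0 (anti i) - z 0 i)
  | inr p => z 0 (anti p.1) - z 0 p.1
  end.

Lemma neg_vec_linear c u v a :
  neg_vec (c *: u + v) a = c * neg_vec u a + neg_vec v a.
Proof.
case: a => [i|p] /=; last by rewrite !mxE.
have sumE (J : finType) (h : J -> {: I * 'I_s}) :
    \sum_k (c *: u + v) 0 (enum_rank (h k)) =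
    c * (\sum_k u 0 (enum_rank (h k))) + \sum_k v 0 (enum_rank (h k)).
  by rewrite mulr_sumr -big_split; apply: eq_bigr => k _; rewrite !mxE.
by rewrite !sumE; ring.
Qed.

Lemma nonneg_vec_linear c u v a :
  nonneg_vec (c *: u + v) a = c * nonneg_vec u a + nonneg_vec v a.
Proof.
case: a => [i|p] /=; last by rewrite !mxE; ring.
have -> : \sum_j (c *: u + v) 0 j = c * (\sum_j u 0 j) + \sum_j v 0 j.
  by rewrite mulr_sumr -big_split; apply: eq_bigr => k _; rewrite !mxE.
by rewrite /lap !mxE; ring.
Qed.

(** For u = k1 and S(y) = c, the bound on A1 gives at most 2(q^2 k + c)^2 + 4qkc - 4|y|^2. The
    choice k = -c/q^2 cancels the square and makes the middle term -4c^2/q. *)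
Lemma neg_vec_form u : u != 0 -> sform (neg_vec u) < 0.
Proof.
move=> u0; rewrite sun_form //.
set c := \sum_p u 0 (enum_rank p); set k : R := - c / q%:R ^+ 2.
have q0 : 0 < q%:R :> R by rewrite ltr0n.
have totE i : tot (neg_vec u) i = k.
  by rewrite /tot /pend /= -/c /k; ring.
have sum_pend : \sum_i pend (neg_vec u) i = c.
  by rewrite /pend pair_bigA; apply: eq_bigr => -[].
have sq_gt0 : 0 < \sum_i \sum_k neg_vec u (inr (i, k)) ^+ 2.
  rewrite pair_bigA /= lt0r; apply/andP; split; last first.
    by apply: sumr_ge0 => p _; exact: sqr_ge0.
  apply: contra u0 => /eqP/psumr_eq0P h; apply/eqP/rowP => j; rewrite mxE.
  have /eqP := h (fun p _ => sqr_ge0 _) (enum_val j) isT.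
  by rewrite -surjective_pairing enum_valK sqrf_eq0 => /eqP.
have S2 : \sum_(i : I) k * (\sum_j cd R i j ^+ 2 * k) <= 2 * q%:R * (k ^+ 2 * q%:R ^+ 3).
  rewrite -sum_cycle_const; apply: ler_sum => i _.
  rewrite -mulr_suml mulrC -mulrA -expr2 mulrC ler_wpM2l ?sqr_ge0 //.
  exact: sum_cd_sq_le.
have S1 : \sum_i pend (neg_vec u) i * (\sum_j cd R i j * tot (neg_vec u) j)
    = c * (q%:R ^+ 2 * k).
  rewrite -sum_pend mulr_suml; apply: eq_bigr => i _.
  by under eq_bigr do rewrite totE; rewrite -mulr_suml sum_cd.
under eq_bigr do rewrite totE.
rewrite S1 sum_pend.
under [X in X + _ + _ + _ - _]eq_bigr do under eq_bigr do rewrite totE.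
under [X in _ + 2 * X * _ + _ - _]eq_bigr do rewrite totE.
rewrite sum_cycle_const.
have kq : q%:R ^+ 2 * k = - c by rewrite /k; field; rewrite gt_eqF.
have E1 : 2 * q%:R * (k ^+ 2 * q%:R ^+ 3) = 2 * c ^+ 2.
  by rewrite -[c in RHS]opprK -kq; ring.
have E2 : 2 * (2 * q%:R * k) * c <= 0.
  have -> : 2 * (2 * q%:R * k) * c = - (4 * c ^+ 2 / q%:R).
    by rewrite /k; field; rewrite gt_eqF.
  rewrite oppr_le0; apply: divr_ge0; last exact: ler0n.
  by rewrite mulr_ge0 ?sqr_ge0 ?ler0n.
rewrite kq; move: S2 E1 E2 sq_gt0.
set A := \sum_i k * _; set B := \sum_i \sum_k0 _ => S2 E1 E2 B0.
by rewrite E1 in S2; lra.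
Qed.

(** Let w = (P - 1)z. It sums to zero, so S(Y) = 0 and Y.Du = 2s|w|^2; the pendant terms total
    8s|w|^2 - 4s|w|^2, at least 4q|w|^2. *)
Lemma nonneg_vec_form z : (q <= s)%N -> 0 <= sform (nonneg_vec z).
Proof.
move=> qs; rewrite sun_form //; set w := fun i => z 0 (anti i) - z 0 i.
have pendE i : pend (nonneg_vec z) i = s%:R * w i.
  by rewrite /pend /= sumr_const card_ord mulr_natl.
have totE i : tot (nonneg_vec z) i = lap (z 0) i + \sum_j z 0 j.
  by rewrite /tot pendE /= /w; ring.
have sum_w : \sum_i w i = 0 by rewrite sumrB sum_antipode subrr.
have -> : \sum_i pend (nonneg_vec z) i = 0.
  by under eq_bigr do rewrite pendE; rewrite -mulr_sumr sum_w mulr0.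
have -> : \sum_i \sum_k nonneg_vec z (inr (i, k)) ^+ 2 = s%:R * \sum_i w i ^+ 2.
  by rewrite mulr_sumr; apply: eq_bigr => i _; rewrite /= sumr_const card_ord mulr_natl.
have -> : \sum_i pend (nonneg_vec z) i * (\sum_j cd R i j * tot (nonneg_vec z) j)
    = 2 * s%:R * \sum_i w i ^+ 2.
  transitivity (\sum_i (2 * s%:R * w i ^+ 2 + s%:R * w i * (q%:R ^+ 2 * \sum_j z 0 j))).
    apply: eq_bigr => i _; under eq_bigr do rewrite totE mulrDr.
    rewrite big_split /= sum_cd_lap -mulr_suml sum_cd // pendE /w; ring.
  by rewrite big_split /= -mulr_suml -!mulr_sumr sum_w; ring.
have -> : \sum_i tot (nonneg_vec z) i * (\sum_j cd R i j ^+ 2 * tot (nonneg_vec z) j)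
    = \sum_i (lap (z 0) i + \sum_j z 0 j) *
        (\sum_j cd R i j ^+ 2 * (lap (z 0) j + \sum_j z 0 j)).
  apply: eq_bigr => i _; rewrite totE; congr (_ * _).
  by apply: eq_bigr => j _; rewrite totE.
have h1 := cycle_form_ge q_gt1 (z 0).
have h2 := lap_antipode_ge0 q_gt1 (z 0).
have h3 : 0 <= (s%:R - q%:R) * \sum_i w i ^+ 2.
  rewrite mulr_ge0 ?subr_ge0 ?ler_nat // sumr_ge0 // => i _; exact: sqr_ge0.
have h4 := mulr_ge0 (ler0n R q) h2.
rewrite mulr0 expr0n /= mulr0 !addr0.
rewrite -[\sum_i (z 0 (anti i) - z 0 i) ^+ 2]/(\sum_i w i ^+ 2) in h4.
move: h1 h3 h4; rewrite mulrDr mulrBl; lra.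
Qed.

(** A pendant, available as s > 0, gives (P - 1)z = 0, so Lz + S(z) = 0 on the cycle. Summing yields
    S(z) = 0, hence Lz = 0, and ALz = 4q Pz - 2S(z) gives z = 0. *)
Lemma nonneg_vec_inj z : (0 < s)%N -> (forall a, nonneg_vec z a = 0) -> z = 0.
Proof.
move=> s_gt0 z0.
have w0 i : z 0 (anti i) - z 0 i = 0 := z0 (inr (i, Ordinal s_gt0)).
have l0 i : lap (z 0) i + \sum_j z 0 j = 0.
  by rewrite -[RHS](z0 (inl i)) /= w0 mulr0 subr0.
have c0 : \sum_j z 0 j = 0.
  have : \sum_i (lap (z 0) i + \sum_j z 0 j) = 0 by apply: big1 => i _.
  rewrite big_split /= sum_lap add0r sum_cycle_const => /eqP.
  by rewrite !mulf_eq0 !pnatr_eq0 (gtn_eqF q_gt0) /= => /eqP.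
apply/rowP => i; rewrite mxE -(antipodeK q_gt0 i).
have := sum_cd_sq_lap q_gt1 (z 0) (anti i).
rewrite c0 big1 => [/esym/eqP|j _]; last first.
  by have := l0 j; rewrite c0 addr0 => ->; rewrite mulr0.
by rewrite mulr0 subr0 !mulf_eq0 !pnatr_eq0 (gtn_eqF q_gt0) /= => /eqP.
Qed.

End SunSubspaces.

(** * The negative inertia of the distance squared matrix *)

Theorem theorem7p1 (R : realType) (q s : nat) :
  (2 <= q)%N -> (q <= s)%N ->
  neg_inertia (dist_sq_matrix R (@Uadj q s)) = (2 * q * s)%N.
Proof.
move=> q_gt1 qs.
have -> : dist_sq_matrix R (@Uadj q s) =
    \matrix_(i, j) (udist (enum_val i) (enum_val j) ^ 2)%:R.
  by apply/matrixP => i j; rewrite !mxE gdist_Uadj.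
have card_pend : #|{: 'I_(2 * q) * 'I_s}| = (2 * q * s)%N.
  by rewrite card_prod !card_ord.
(* The count takes the form of the dimension of the domain of [neg_vec]. *)
rewrite -card_pend.
apply: (neg_inertia_forms (K := fun a b => (udist a b ^ 2)%:R)
  (f := @neg_vec R q s) (g := @nonneg_vec R q s q_gt1)).
- by move=> a b; rewrite udistC.
- by rewrite card_pend card_sum card_prod !card_ord addnC.
- exact: neg_vec_linear.
- exact: nonneg_vec_linear.
- exact: neg_vec_form.
- by move=> z; apply: nonneg_vec_form.
- move=> z; apply: nonneg_vec_inj; exact: leq_trans (ltnW q_gt1) qs.
Qed.
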